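(* Let $k\ge1$, let $\alpha_1,\dots,\alpha_k>0$ and $\beta_1,\dots,\beta_k$ be real, and put $\gamma_j=\alpha_{j+1}+\alpha_{j+2}+\dots+\alpha_k+\beta_j+\beta_{j+1}+\dots+\beta_k$ for $j=1,\dots,k$; assume $\gamma_j>0$ for all $j$. Let $(x_1,\dots,x_k)$ have the joint density $$f_1(x_1,\dots,x_k)=C_1\,x_1^{\alpha_1-1}(1-x_1)^{\beta_1}x_2^{\alpha_2-1}(1-x_1-x_2)^{\beta_2}\cdots x_k^{\alpha_k-1}(1-x_1-\dots-x_k)^{\beta_k-1}$$ on $\{x_j>0,\ 0<x_1+\dots+x_j<1,\ j=1,\dots,k\}$ and $0$ elsewhere, where $C_1$ is the normalizing constant. Let $(v_1,\dots,v_k)$ be a vector of positive real random variables with an arbitrary joint density $f(v_1,\dots,v_k)$ on $(0,\infty)^k$, independent of $(x_1,\dots,x_k)$. Let $y_j=\dfrac{x_j}{1-x_1-\dots-x_{j-1}}$ (with denominator $1$ for $j=1$), let $u_j=v_j/y_j$, $j=1,\dots,k$, and let $g(u_1,\dots,u_k)$ be the joint density of $(u_1,\dots,u_k)$. Then, for (almost every) $(u_1,\dots,u_k)\in(0,\infty)^k$, $$I_{u_j,j=1,\dots,k}^{(\alpha_j,\gamma_j),j=1,\dots,k}f(u_1,\dots,u_k)=\Big\{\prod_{j=1}^k\frac{\Gamma(\alpha_j)}{\Gamma(\alpha_j+\gamma_j)}\Big\}g(u_1,\dots,u_k).$$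
   Context: The multivariable Kober fractional integral operator of the first kind is defined, for parameters $\zeta_j$ and $\alpha_j>0$, by $$I_{u_j,j=1,\dots,k}^{(\zeta_j,\alpha_j),j=1,\dots,k}f(u_1,\dots,u_k)=\Big\{\prod_{j=1}^k\frac{u_j^{-\zeta_j-\alpha_j}}{\Gamma(\alpha_j)}\Big\}\int_{0}^{u_1}\cdots\int_{0}^{u_k}\Big\{\prod_{j=1}^k(u_j-v_j)^{\alpha_j-1}v_j^{\zeta_j}\Big\}f(v_1,\dots,v_k)\,dv_1\cdots dv_k;$$ here it is applied with $\zeta_j=\alpha_j$ and $\alpha_j$ replaced by $\gamma_j$. *)

(* Defs.v *)
From HB Require Import structures.
From mathcomp Require Import all_boot all_order all_algebra.
From mathcomp Require Import all_classical all_reals all_analysis.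
Set Implicit Arguments.
Unset Strict Implicit.
Unset Printing Implicit Defensive.
Import Order.TTheory GRing.Theory Num.Theory.
Import numFieldNormedType.Exports.
Local Open Scope classical_set_scope.
Local Open Scope ring_scope.

Definition Gamma {R : realType} (a : R) : R :=
  fine (\int[@lebesgue_measure R]_(t in `]0%R, +oo[) ((t `^ (a - 1)) * expR (- t))%:E)%E.

(** Iterated Lebesgue integral over R^k (k-tuples), for nonnegative
    extended-real integrands: int dx_1 ... int dx_k F(x_1,...,x_k).
    For nonnegative measurable F this is the integral w.r.t. the
    k-dimensional Lebesgue measure (Tonelli). *)
Fixpoint iint {R : realType} (k : nat) : (k.-tuple R -> \bar R) -> \bar R :=
  match k with
  | 0 => fun F => F [tuple]
  | k'.+1 => fun F =>
      (\int[@lebesgue_measure R]_(x in [set: R]) iint (fun t => F (cons_tuple x t)))%E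
  end.

Definition tnull {R : realType} (k : nat) (N : set (k.-tuple R)) : Prop :=
  measurable N /\ iint (fun u => (\1_N u : R)%:E) = 0%E.

Definition psum {R : realType} (k : nat) (x : k.-tuple R) (j : nat) : R :=
  \sum_(i < k | (i < j)%N) tnth x i.

Definition gam {R : realType} (k : nat) (alpha beta : 'I_k -> R) (j : 'I_k) : R :=
  \sum_(l < k | (j < l)%N) alpha l + \sum_(l < k | (j <= l)%N) beta l.

Definition dir_region {R : realType} (k : nat) : set (k.-tuple R) :=
  [set x | forall j : 'I_k, 0 < tnth x j /\ 0 < psum x j.+1 /\ psum x j.+1 < 1].

Definition f1_unnorm {R : realType} (k : nat) (alpha beta : 'I_k -> R)
    (x : k.-tuple R) : R :=
  \1_(@dir_region R k) x *
  \prod_(j < k) (tnth x j `^ (alpha j - 1) *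
      (1 - psum x j.+1) `^ (if val j == k.-1 then beta j - 1 else beta j)).

Definition C1 {R : realType} (k : nat) (alpha beta : 'I_k -> R) : R :=
  (fine (iint (fun x => (f1_unnorm alpha beta x)%:E)))^-1.

Definition f1 {R : realType} (k : nat) (alpha beta : 'I_k -> R)
    (x : k.-tuple R) : R :=
  C1 alpha beta * f1_unnorm alpha beta x.

Definition ytr {R : realType} (k : nat) (x : k.-tuple R) : k.-tuple R :=
  [tuple tnth x i / (1 - psum x i) | i < k].

Definition utr {R : realType} (k : nat) (x v : k.-tuple R) : k.-tuple R :=
  [tuple tnth v i / tnth (ytr x) i | i < k].

Definition kober {R : realType} (k : nat) (zeta a : 'I_k -> R)
    (f : k.-tuple R -> R) (u : k.-tuple R) : \bar R :=
  ((\prod_(j < k) (tnth u j `^ (- zeta j - a j) / Gamma (a j)))%:E *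
   iint (fun v : k.-tuple R =>
     (\1_[set w : k.-tuple R | forall j, 0 < tnth w j < tnth u j] v *
      \prod_(j < k) ((tnth u j - tnth v j) `^ (a j - 1) * tnth v j `^ zeta j) *
      f v)%:E))%E.

(* Main.v *)
(** In the variables [y_j = x_j / (1 - x_1 - ... - x_(j-1))] the density [f_1]
    factors: the [y_j] are independent, and [y_j] is beta distributed with
    parameters [alpha_j] and [gamma_j] (stick breaking).  Hence by Tonelli and
    the scaling [v = u y] the density of [u = v / y] is almost everywhere
      [C_1 \int (prod_j y_j^alpha_j (1 - y_j)^(gamma_j - 1)) f (u y) dy]
    over the unit cube, and scaling back by [y = v / u] turns this integral
    into the Kober integral.  The constants match because
    [Gamma a * Gamma b = Gamma (a + b) * B (a, b)]. *)
Require Import Defs.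
From HB Require Import structures.
From mathcomp Require Import all_boot all_order all_algebra.
From mathcomp Require Import all_classical all_reals all_analysis.
From mathcomp Require Import measurable_realfun ring lra.
Import Order.TTheory GRing.Theory Num.Theory.
Import numFieldNormedType.Exports.
Set Implicit Arguments.
Unset Strict Implicit.
Unset Printing Implicit Defensive.
Local Open Scope classical_set_scope.
Local Open Scope ring_scope.

(** * Iterated integrals *)

Section iint.
Context {R : realType}.
Implicit Types k m : nat.
Local Open Scope ereal_scope.
Notation mu := (@lebesgue_measure R).

(** [iint] is a recursion on the dimension and not an integral against a product measure, so
    linearity, monotonicity, Tonelli and scaling are obtained by induction on [k], always for
    nonnegative measurable integrands, where infinite values are harmless. The induction also avoids
    any [k]-dimensional Jacobian: once [x_1] is fixed, the stick-breaking map only rescales the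
    other coordinates by [1 - x_1], so one-variable affine substitutions suffice. The powers of
    [1 - x_1] released at each step add up to the exponent [gamma_1 - 1], which is where [gam] comes
    from. Laws are compared through integrals against arbitrary nonnegative test functions. Since
    [g] is known only through its integrals over measurable sets, the pointwise identity needs a
    uniqueness argument, in which the finite total mass of [g] is essential: the competing density
    is extended-real valued and not known in advance to be finite. *)

Lemma iint_ge0 k (F : k.-tuple R -> \bar R) :
  (forall t, 0 <= F t) -> 0 <= iint F.
Proof.
elim: k F => [|k IH] F F0 /=; first exact: F0.
by apply: integral_ge0 => x _; apply: IH.
Qed.

Lemma measurable_cons_tuple k :
  measurable_fun [set: R * k.-tuple R]
    (fun p : R * k.-tuple R => cons_tuple p.1 p.2).
Proof.
exact: (@measurable_cons _ _ (R * k.-tuple R)%type R fst k snd).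
Qed.

Lemma measurable_fun_cons_pair d (T : measurableType d) k
    (F : T * k.+1.-tuple R -> \bar R) :
  measurable_fun [set: T * k.+1.-tuple R] F ->
  measurable_fun [set: (T * R) * k.-tuple R]
    (fun p : (T * R) * k.-tuple R => F (p.1.1, cons_tuple p.1.2 p.2)).
Proof.
move=> mF; apply: (measurableT_comp mF).
apply/measurable_fun_pairP; split => /=.
  exact: (measurableT_comp measurable_fst measurable_fst).
apply: (@measurable_cons _ _ ((T * R) * k.-tuple R)%type R (fun p => p.1.2) k (fun p => p.2)).
  exact: (measurableT_comp measurable_snd measurable_fst).
exact: measurable_snd.
Qed.

(** The parameter space is arbitrary so that the induction can move the first coordinate of the
    tuple into it: the hypothesis is used with [T * R], and the measurability half of Tonelli
    integrates that coordinate out. *)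
Lemma measurable_iint d (T : measurableType d) k (F : T * k.-tuple R -> \bar R) :
  (forall p, 0 <= F p) -> measurable_fun [set: T * k.-tuple R] F ->
  measurable_fun [set: T] (fun p => iint (fun t => F (p, t))).
Proof.
elim: k d T F => [|k IH] d T F F0 mF /=.
  by apply: (measurableT_comp mF); exact: pair2_measurable.
have := IH _ (T * R)%type (fun p => F (p.1.1, cons_tuple p.1.2 p.2)) (fun=> F0 _)
  (measurable_fun_cons_pair mF).
move/(measurable_fun_fubini_tonelli_F (m2 := mu)) => /=; apply => p.
by apply: iint_ge0.
Qed.

Lemma measurable_iint_cons k (F : k.+1.-tuple R -> \bar R) :
  (forall t, 0 <= F t) -> measurable_fun [set: k.+1.-tuple R] F ->
  measurable_fun [set: R] (fun x => iint (fun t => F (cons_tuple x t))).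
Proof.
move=> F0 mF.
apply: (@measurable_iint _ R k (fun p => F (cons_tuple p.1 p.2))) => //.
by apply: (measurableT_comp mF); exact: measurable_cons_tuple.
Qed.

Lemma measurable_fun_consl k (F : k.+1.-tuple R -> \bar R) x :
  measurable_fun [set: k.+1.-tuple R] F ->
  measurable_fun [set: k.-tuple R] (fun t => F (cons_tuple x t)).
Proof.
move=> mF; apply: (measurableT_comp mF).
exact: (@measurable_cons _ _ (k.-tuple R) R (cst x) k id).
Qed.

(** The factor may be [+oo]; infinite multiples are what later turns a vanishing integral into a
    null set. *)
Lemma iintZl k (F : k.-tuple R -> \bar R) c :
  0 <= c -> (forall t, 0 <= F t) -> measurable_fun [set: k.-tuple R] F ->
  iint (fun t => c * F t) = c * iint F.
Proof.
move=> c0; elim: k F => [//|k IH] F F0 mF /=.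
rewrite -ge0_integralZl//; last 2 first.
- exact: measurable_iint_cons.
- by move=> x _; apply: iint_ge0.
by apply: eq_integral => x _; rewrite IH//; exact: measurable_fun_consl.
Qed.

Lemma iintD k (F G : k.-tuple R -> \bar R) :
  (forall t, 0 <= F t) -> measurable_fun [set: k.-tuple R] F ->
  (forall t, 0 <= G t) -> measurable_fun [set: k.-tuple R] G ->
  iint (fun t => F t + G t) = iint F + iint G.
Proof.
elim: k F G => [//|k IH] F G F0 mF G0 mG /=.
rewrite -ge0_integralD//; last 4 first.
- by move=> x _; apply: iint_ge0.
- exact: measurable_iint_cons.
- by move=> x _; apply: iint_ge0.
- exact: measurable_iint_cons.
by apply: eq_integral => x _; rewrite IH//; exact: measurable_fun_consl.
Qed.

Lemma ge0_le_iint k (F G : k.-tuple R -> \bar R) :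
  (forall t, 0 <= F t) -> measurable_fun [set: k.-tuple R] F ->
  measurable_fun [set: k.-tuple R] G -> (forall t, F t <= G t) ->
  iint F <= iint G.
Proof.
elim: k F G => [|k IH] F G F0 mF mG FG /=; first exact: FG.
have G0 t : 0 <= G t by exact: le_trans (FG t).
apply: ge0_le_integral => //.
- by move=> x _; apply: iint_ge0.
- exact: measurable_iint_cons.
- exact: measurable_iint_cons.
- by move=> x _; apply: IH => //; exact: measurable_fun_consl.
Qed.

(** The outer variable passes the coordinates of the tuple one at a time, each time by two-variable
    Tonelli. *)
Lemma integral_iint k (F : R * k.-tuple R -> \bar R) :
  (forall p, 0 <= F p) -> measurable_fun [set: R * k.-tuple R] F ->
  \int[mu]_x iint (fun t => F (x, t)) = iint (fun t => \int[mu]_x F (x, t)).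
Proof.
elim: k F => [//|k IH] F F0 mF /=.
have mF2 := measurable_fun_cons_pair mF.
have mG : measurable_fun [set: (R * R)]
   (fun p => iint (fun t => F (p.1, cons_tuple p.2 t))).
  by apply: (measurable_iint _ mF2).
have /= -> := fubini_tonelli (m1 := mu) (m2 := mu) _ mG (fun=> iint_ge0 (fun=> F0 _)).
apply: eq_integral => y _.
apply: (IH (fun p => F (p.1, cons_tuple y p.2))) => //.
apply: (@measurableT_comp _ _ _ _ _ _ _ _ (fun p : R * k.-tuple R => ((p.1, y), p.2)) mF2).
apply: measurable_fun_pair => //.
by apply: measurable_fun_pair => //; exact: measurable_fst.
Qed.

Lemma iint_swap j k (F : j.-tuple R * k.-tuple R -> \bar R) :
  (forall p, 0 <= F p) -> measurable_fun [set: j.-tuple R * k.-tuple R] F ->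
  iint (fun s => iint (fun t => F (s, t))) = iint (fun t => iint (fun s => F (s, t))).
Proof.
elim: j F => [//|j IH] F F0 mF /=.
have mF3 : measurable_fun [set: (R * k.-tuple R) * j.-tuple R]
   (fun p : (R * k.-tuple R) * j.-tuple R => F (cons_tuple p.1.1 p.2, p.1.2)).
  apply: (measurableT_comp mF); apply/measurable_fun_pairP; split => /=.
    apply: (@measurable_cons _ _ ((R * k.-tuple R) * j.-tuple R)%type R
      (fun p => p.1.1) j (fun p => p.2)); last exact: measurable_snd.
    exact: (measurableT_comp measurable_fst measurable_fst).
  exact: (measurableT_comp measurable_snd measurable_fst).
rewrite -(integral_iint (F := fun p => iint (fun s => F (cons_tuple p.1 s, p.2)))); last 2 first.
- by move=> p; apply: iint_ge0.
- exact: (measurable_iint _ mF3).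
apply: eq_integral => x _.
apply: (IH (fun p => F (cons_tuple x p.1, p.2))) => //.
apply: (@measurableT_comp _ _ _ _ _ _ _ _ (fun p : j.-tuple R * k.-tuple R => ((x, p.2), p.1)) mF3).
apply: measurable_fun_pair => //.
by apply: measurable_fun_pair => //; exact: measurable_snd.
Qed.

End iint.

(** * Affine changes of variables *)

Section change_of_variables.
Context {R : realType}.
Local Open Scope ereal_scope.
Notation mu := (@lebesgue_measure R).

(** The image of Lebesgue measure under [x |-> c * x + b], multiplied by [c], gives half-open
    intervals their length, hence is Lebesgue measure by uniqueness. *)
Lemma integral_affine (F : R -> \bar R) (c b : R) : (0 < c)%R ->
  (forall x, 0 <= F x) -> measurable_fun [set: R] F ->
  \int[mu]_x F x = c%:E * \int[mu]_x F (c * x + b)%R.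
Proof.
move=> c0 F0 mF.
pose phi := (fun x : measurableTypeR R => (c * x + b)%R : measurableTypeR R).
have mphi : measurable_fun [set: measurableTypeR R] phi.
  by apply: measurable_funD => //; exact: measurable_funM.
pose push : {measure set (measurableTypeR R) -> \bar R} :=
  measure_function_pushforward__canonical__measure_function_Measure mu mphi.
pose nu := mscale (NngNum (ltW c0)) push.
have munu A : measurable A -> mu A = nu A.
  move=> mA; apply: lebesgue_measure_unique => //= _ [[x y]] _ <-.
  rewrite /nu /mscale /= /pushforward.
  have -> : phi @^-1` `]x, y]%classic = `]((x - b) / c)%R, ((y - b) / c)%R]%classic.
    apply/seteqP; split => z /=; rewrite !in_itv /= /phi.
      by rewrite ltr_pdivrMr// ler_pdivlMr// ltrBlDr lerBrDr mulrC.
    by rewrite ltr_pdivrMr// ler_pdivlMr// ltrBlDr lerBrDr mulrC.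
  rewrite !lebesgue_measure_itv /= !lte_fin ltr_pM2r ?invr_gt0// ltrD2r.
  case: ifPn => _; last by rewrite mule0.
  rewrite -!EFinD -EFinM; congr EFin.
  by field; rewrite gt_eqF.
transitivity (\int[nu]_x F x).
  by apply: eq_measure_integral => A mA _; exact: munu.
rewrite ge0_integral_mscale//; congr (_ * _).
by rewrite ge0_integral_pushforward.
Qed.

(** Serves two substitutions: [v = u y] coordinatewise, and, with a constant tuple, the scaling of
    the remaining stick. *)
Definition tmul k (c t : k.-tuple R) : k.-tuple R :=
  [tuple (tnth c i * tnth t i)%R | i < k].

Lemma tmul_cons k a (c : k.-tuple R) x t :
  tmul (cons_tuple a c) (cons_tuple x t) = cons_tuple (a * x)%R (tmul c t).
Proof.
apply: eq_from_tnth => i; rewrite tnth_mktuple.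
by case: (unliftP ord0 i) => [j ->|->]; rewrite ?tnthS// tnth_mktuple.
Qed.

Lemma measurable_tmul k :
  measurable_fun [set: k.-tuple R * k.-tuple R]
    (fun p : k.-tuple R * k.-tuple R => tmul p.1 p.2).
Proof.
apply/measurable_fun_tnthP => i /=.
rewrite (_ : _ \o _ = (fun p : k.-tuple R * k.-tuple R => tnth p.1 i * tnth p.2 i)%R).
  by apply: measurable_funM; [apply: (measurableT_comp (measurable_tnth i) measurable_fst)
    | apply: (measurableT_comp (measurable_tnth i) measurable_snd)].
by apply/funext => p /=; rewrite tnth_mktuple.
Qed.

Lemma measurable_fun_tmul k (F : k.-tuple R -> \bar R) c :
  measurable_fun [set: k.-tuple R] F ->
  measurable_fun [set: k.-tuple R] (fun t => F (tmul c t)).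
Proof.
move=> mF; apply: (measurableT_comp mF).
apply: (@measurableT_comp _ _ _ _ _ _ _ _ (pair c) (@measurable_tmul k)).
exact: pair1_measurable.
Qed.

Lemma iint_tmul k (c : k.-tuple R) (F : k.-tuple R -> \bar R) :
  (forall j, 0 < tnth c j)%R ->
  (forall x, 0 <= F x) -> measurable_fun [set: k.-tuple R] F ->
  iint F = (\prod_(j < k) tnth c j)%:E * iint (fun t => F (tmul c t)).
Proof.
elim: k c F => [|k IH] c F c0 F0 mF.
  rewrite /= big_ord0 mul1e; by congr F; apply: eq_from_tnth => -[].
case/tupleP: c c0 => a c c0.
have a0 : (0 < a)%R by have := c0 ord0.
have c1 j : (0 < tnth c j)%R by have := c0 (lift ord0 j); rewrite tnthS.
rewrite big_ord_recl /=.
under eq_bigr do rewrite tnthS.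
pose G x := iint (fun t => F (cons_tuple x (tmul c t))).
have mG : measurable_fun [set: R] G.
  (* The scale 1 in front leaves the first coordinate alone, as in [G]. *)
  have := measurable_iint_cons (fun=> F0 _) (measurable_fun_tmul (cons_tuple 1%R c) mF).
  apply: eq_measurable_fun => x _; rewrite /G; congr iint; apply/funext => t.
  by rewrite tmul_cons mul1r.
have G0 x : 0 <= G x by exact: iint_ge0.
transitivity (\int[mu]_x ((\prod_(i < k) tnth c i)%:E * G x)).
  by apply: eq_integral => x _; rewrite (IH c)//; exact: measurable_fun_consl.
rewrite ge0_integralZl//; last by rewrite lee_fin prodr_ge0// => i _; exact: ltW.
rewrite (integral_affine 0%R a0 G0 mG) muleA -EFinM mulrC; congr (_ * _).
apply: eq_integral => x _; rewrite /G addr0; congr iint; apply/funext => t.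
by rewrite tmul_cons.
Qed.
End change_of_variables.

(** * Gamma and beta integrals *)

Section gamma_beta.
Context {R : realType}.
Notation mu := (@lebesgue_measure R).
Implicit Types a b t : R.

(** The domain is encoded by an indicator, so that shifts, scalings and Tonelli apply on the whole
    line. Neither this nor [beta_dens] is normalized. *)
Definition gamma_dens a t : R :=
  \1_(`]0, +oo[%classic) t * (t `^ (a - 1) * expR (- t)).

Definition beta_dens a b t : R :=
  \1_(`]0, 1[%classic) t * (t `^ (a - 1) * (1 - t) `^ (b - 1)).

Definition beta_int a b : \bar R := (\int[mu]_t (beta_dens a b t)%:E)%E.
Definition gamma_int a : \bar R := (\int[mu]_t (gamma_dens a t)%:E)%E.

Lemma gamma_dens_ge0 a t : 0 <= gamma_dens a t.
Proof. by rewrite !mulr_ge0 ?powR_ge0 ?expR_ge0. Qed.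

Lemma beta_dens_ge0 a b t : 0 <= beta_dens a b t.
Proof. by rewrite !mulr_ge0 ?powR_ge0. Qed.

Lemma gamma_densE a t : 0 < t -> gamma_dens a t = t `^ (a - 1) * expR (- t).
Proof. by move=> t0; rewrite /gamma_dens indicE mem_set ?mul1r//= in_itv/= t0. Qed.

Lemma gamma_dens0 a t : t <= 0 -> gamma_dens a t = 0.
Proof.
move=> t0; rewrite /gamma_dens indicE memNset ?mul0r//= in_itv/= andbT.
by apply/negP; rewrite -leNgt.
Qed.

Lemma measurable_gamma_dens a : measurable_fun [set: R] (gamma_dens a).
Proof.
apply: measurable_funM; first exact: measurable_indic.
apply: measurable_funM; first exact: measurable_powR.
by apply: measurableT_comp; [exact: measurable_expR | exact: measurable_funN].
Qed.

Lemma measurable_beta_dens a b : measurable_fun [set: R] (beta_dens a b).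
Proof.
apply: measurable_funM; first exact: measurable_indic.
apply: measurable_funM; first exact: measurable_powR.
apply: (measurableT_comp (measurable_powR _)).
by apply: measurable_funB.
Qed.

Lemma emeasurable_gamma_dens a :
  measurable_fun [set: R] (fun t => (gamma_dens a t)%:E).
Proof. by apply/measurable_EFinP; exact: measurable_gamma_dens. Qed.

Lemma emeasurable_beta_dens a b :
  measurable_fun [set: R] (fun t => (beta_dens a b t)%:E).
Proof. by apply/measurable_EFinP; exact: measurable_beta_dens. Qed.

Lemma Gamma_gamma_int a : Gamma a = fine (gamma_int a).
Proof.
rewrite /Gamma /gamma_int integral_mkcond; congr fine.
apply: eq_integral => t _; rewrite patchE /gamma_dens indicE.
by case: ifPn; rewrite ?mul1r ?mul0r.
Qed.

(** The convolution argument. Being an identity of extended reals between nonnegative integrals, it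
    holds for all real [a] and [b], before any question of convergence. *)
Lemma gamma_int_mul a b :
  (gamma_int a * gamma_int b = gamma_int (a + b) * beta_int a b)%E.
Proof.
pose F (p : R * R) : \bar R := ((gamma_dens a p.1)%:E * (gamma_dens b (p.2 - p.1))%:E)%E.
have F0 p : (0 <= F p)%E by rewrite mule_ge0 ?lee_fin ?gamma_dens_ge0.
have mF : measurable_fun [set: R * R] F.
  apply: emeasurable_funM; apply/measurable_EFinP.
    exact: (measurableT_comp (measurable_gamma_dens a) measurable_fst).
  apply: (measurableT_comp (measurable_gamma_dens b)).
  apply: measurable_funB; [exact: measurable_snd | exact: measurable_fst].
transitivity (\int[mu]_s \int[mu]_w F (s, w))%E.
  rewrite /gamma_int -ge0_integralZr//; last 3 first.
  - exact: emeasurable_gamma_dens.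
  - by move=> t _; rewrite lee_fin gamma_dens_ge0.
  - by apply: integral_ge0 => t _; rewrite lee_fin gamma_dens_ge0.
  apply: eq_integral => s _.
  rewrite /F /= ge0_integralZl//; last 3 first.
  - apply: (measurableT_comp (emeasurable_gamma_dens b)).
    by apply: measurable_funB.
  - by move=> t _; rewrite lee_fin gamma_dens_ge0.
  - by rewrite lee_fin gamma_dens_ge0.
  (* The substitution [t = w - s], with [w] the sum of the two gamma variables. *)
  rewrite (integral_affine (- s) ltr01).
  - by rewrite mul1e; congr (_ * _)%E; apply: eq_integral => t _; rewrite mul1r.
  - by move=> t; rewrite lee_fin gamma_dens_ge0.
  - exact: emeasurable_gamma_dens.
have -> := fubini_tonelli (m1 := mu) (m2 := mu) _ mF F0.
rewrite /gamma_int -ge0_integralZr//; last 3 first.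
- exact: emeasurable_gamma_dens.
- by move=> t _; rewrite lee_fin gamma_dens_ge0.
- by apply: integral_ge0 => t _; rewrite lee_fin beta_dens_ge0.
apply: eq_integral => w _.
have [w0|w0] := leP w 0.
  rewrite gamma_dens0// mul0e integral0_eq// => s _; rewrite /F /=.
  have [s0|s0] := leP s 0; first by rewrite gamma_dens0// mul0e.
  by rewrite [gamma_dens b _]gamma_dens0 ?mule0// subr_le0 ltW// (le_lt_trans w0).
(* For fixed [w > 0], put [s = w y]. The Jacobian [w] joins [w^(a-1)] and [w^(b-1)] to give
   [w^(a+b-1)], and the exponentials combine to [exp(-w)], so that the variables separate. *)
rewrite (integral_affine 0 w0) //; last exact: measurable_fun_pair1.
rewrite -ge0_integralZl ?lee_fin ?(ltW w0)//; last first.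
  apply: (measurableT_comp (measurable_fun_pair1 w mF)).
  by apply: measurable_funD => //; exact: measurable_funM.
rewrite /beta_int -ge0_integralZl ?lee_fin ?gamma_dens_ge0//; last 2 first.
- exact: emeasurable_beta_dens.
- by move=> t _; rewrite lee_fin beta_dens_ge0.
apply: eq_integral => y _; rewrite addr0 /F /= -!EFinM; congr EFin.
have [y0|y0] := leP y 0.
  rewrite gamma_dens0 ?mul0r ?mulr0 ?pmulr_rle0// /beta_dens indicE memNset ?mul0r ?mulr0//=.
  by rewrite in_itv/= => /andP[]; rewrite ltNge y0.
have [y1|y1] := leP 1 y.
  rewrite [gamma_dens b _]gamma_dens0 ?mulr0; last by rewrite subr_le0 ler_peMr// ltW.
  rewrite /beta_dens indicE memNset ?mul0r ?mulr0//=.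
  by rewrite in_itv/= => /andP[_]; rewrite ltNge y1.
have y1' : 0 < 1 - y by rewrite subr_gt0.
rewrite !gamma_densE ?mulr_gt0//; last by rewrite -[X in X - _]mulr1 -mulrBr mulr_gt0.
rewrite /beta_dens indicE mem_set ?mul1r/= ?in_itv/= ?y0//.
rewrite -[X in X - w * y]mulr1 -mulrBr !powRM ?(ltW w0) ?(ltW y0) ?(ltW y1')//.
have -> : expR (- w) = expR (- (w * y)) * expR (- (w * (1 - y))).
  by rewrite -expRD; congr expR; ring.
have -> : w `^ (a + b - 1) = w * w `^ (a - 1) * w `^ (b - 1).
  rewrite -{2}(powRr1 (ltW w0)) -!powRD; first by congr powR; ring.
  - by rewrite (gt_eqF w0) implybT.
  - by rewrite (gt_eqF w0) implybT.
by ring.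
Qed.

End gamma_beta.

(** * Positivity and finiteness of the Gamma integral *)

Section gamma_finite.
Context {R : realType}.
Notation mu := (@lebesgue_measure R).
Implicit Types a b t : R.

(** If the integral were 0, so would be that of [+oo] times the integrand; but this multiple
    dominates the indicator of []0, 1[], whose integral is 1. *)
Lemma gamma_int_gt0 a : (0 < gamma_int a)%E.
Proof.
have g0 : (0 <= gamma_int a)%E.
  by apply: integral_ge0 => t _; rewrite lee_fin gamma_dens_ge0.
rewrite lt_neqAle g0 andbT; apply/eqP => gz.
have : (\int[mu]_t (+oo * (gamma_dens a t)%:E) = 0)%E.
  rewrite ge0_integralZl//; last 2 first.
  - exact: emeasurable_gamma_dens.
  - by move=> t _; rewrite lee_fin gamma_dens_ge0.
  by rewrite -/(gamma_int a) -gz mule0.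
apply/eqP; rewrite gt_eqF//.
apply: (@lt_le_trans _ _ (\int[mu]_t (\1_(`]0, 1[%classic) t : R)%:E)%E).
  rewrite integral_indic//= setIT lebesgue_measure_itv/= lte_fin ltr01.
  by rewrite -EFinD subr0 lte_fin.
apply: ge0_le_integral => //.
- by apply/measurable_EFinP; exact: measurable_indic.
- by apply: measurable_funeM; exact: emeasurable_gamma_dens.
move=> t _; rewrite indicE; case: (boolP (_ \in _)) => /= [|_]; last first.
  by rewrite mule_ge0// lee_fin gamma_dens_ge0.
rewrite inE/= in_itv/= => /andP[t0 _].
rewrite gamma_densE// gt0_mulye ?leey// lte_fin.
by rewrite mulr_gt0 ?powR_gt0 ?expR_gt0.
Qed.

Lemma integral_powR01 a : 0 < a ->
  (\int[mu]_(t in `]0%R, 1%R]) (t `^ (a - 1))%:E <= (a^-1)%:E)%E.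
Proof.
move=> a0.
(* The sets exhaust []0, 1]] and stay away from the singularity at 0. Starting at 2 keeps the left
   endpoint strictly below 1, as the fundamental theorem of calculus requires. *)
pose F (n : nat) : set R := `[n.+2%:R^-1, 1%R]%classic.
have FE : \bigcup_n F n = `]0, 1]%classic.
  apply/seteqP; split => [t [n _]|t]; rewrite /F /= !in_itv/=.
    by move=> /andP[+ ->]; rewrite andbT; apply: lt_le_trans; rewrite invr_gt0.
  move=> /andP[t0 t1]; exists (Num.truncn t^-1) => //=.
  rewrite in_itv/= t1 andbT invf_ple ?posrE ?ltr0n//.
  by rewrite (le_trans (ltW (truncnS_gt _)))// ler_nat.
have mp D : measurable_fun D (fun t : R => (t `^ (a - 1))%:E).
  by apply: measurable_funTS; apply/measurable_EFinP; exact: measurable_powR.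
have cvgF : (\int[mu]_(t in F n) (t `^ (a - 1))%:E @[n --> \oo] -->
    \int[mu]_(t in `]0%R, 1%R]) (t `^ (a - 1))%:E)%E.
  rewrite -FE; apply: ge0_nondecreasing_set_cvg_integral.
  - move=> m n mn; apply/subsetPset => t; rewrite /F /= !in_itv/= => /andP[mt ->].
    by rewrite andbT (le_trans _ mt)// lef_pV2 ?posrE ?ltr0n// ler_nat !ltnS.
  - by move=> i; exact: measurable_itv.
  - by move=> i; exact: mp.
  - by move=> i t _; rewrite lee_fin powR_ge0.
apply: (cvge_to_le cvgF).
apply: nearW => n.
have n0 : (0 : R) < n.+2%:R^-1 by rewrite invr_gt0.
have der (x : R) : 0 < x -> is_derive x 1 (fun t : R => t `^ a / a) (x `^ (a - 1)).
  move=> x0; have := is_derive1_powR a x0 => dx.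
  rewrite (_ : (fun t => _) = a^-1 \*: (@powR R ^~ a)); last first.
    by apply/funext => t /=; rewrite mulrC.
  by apply: is_derive_eq; rewrite /GRing.scale /= mulKf ?gt_eqF.
have cder (x : R) : 0 < x -> {for x, continuous (fun t : R => t `^ a / a)}.
  move=> x0; apply: differentiable_continuous; apply/derivable1_diffP.
  by have [] := der x x0.
rewrite (@continuous_FTC2 _ _ (fun t : R => t `^ a / a)).
- rewrite powR1 div1r -EFinB lee_fin gerBl.
  by rewrite divr_ge0 ?powR_ge0// ltW.
- by rewrite invf_lt1// ltr1n.
- apply: derivable_within_continuous => x; rewrite in_itv/= => /andP[nx _].
  apply: ex_derive; apply: is_derive1_powR.
  exact: lt_le_trans nx.
- split.
  + move=> x; rewrite in_itv/= => /andP[nx _].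
    by have [] := der x (lt_trans n0 nx).
  + exact/cvg_at_right_filter/cder.
  + exact/cvg_at_left_filter/cder.
- move=> x; rewrite in_itv/= => /andP[nx _].
  by rewrite derive1E; have [_ ->] := der x (lt_trans n0 nx).
Qed.

Lemma powR_le_expR a t : 0 < a -> 1 <= t ->
  t `^ (a - 1) <= (2 * a) `^ a * expR (t / 2).
Proof.
move=> a0 t1; have t0 : 0 < t by exact: lt_le_trans t1.
apply: (@le_trans _ _ (t `^ a)); first by rewrite ler_powR// gerBl.
(* From [s <= exp s] at [s = t / (2 a)]; the scale [2 a] is chosen so that the power [a] yields
   exactly [exp(t/2)], half of the available decay. *)
have h : t <= (2 * a) * expR (t / (2 * a)).
  rewrite mulrC -ler_pdivrMr ?mulr_gt0//.
  by rewrite (le_trans _ (expR_ge1Dx _))// lerDr.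
apply: (le_trans (ge0_ler_powR (ltW a0) _ _ h)).
- by rewrite nnegrE ltW.
- by rewrite nnegrE mulr_ge0 ?expR_ge0 ?mulr_ge0// ltW.
rewrite powRM ?expR_ge0 ?mulr_ge0 ?(ltW a0)// -expRM.
by rewrite le_eqVlt; apply/orP; left; apply/eqP; congr (_ * expR _); field; rewrite gt_eqF.
Qed.

Lemma gamma_int_lty a : 0 < a -> (gamma_int a < +oo)%E.
Proof.
move=> a0.
pose F : R -> \bar R := (fun t => (t `^ (a - 1))%:E) \_ `]0%R, 1%R].
(* The factor 2 cancels the rate [1/2] of the exponential density, leaving [(2 a)^a exp(-t/2)], a
   majorant for [t > 1]. *)
pose G t : \bar R := (((2 * a) `^ a * 2)%:E * (exponential_pdf 2^-1 t)%:E)%E.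
have F0 t : (0 <= F t)%E.
  by rewrite /F patchE; case: ifP; rewrite ?lee_fin ?powR_ge0.
have C0 : 0 <= (2 * a) `^ a * 2 by rewrite mulr_ge0 ?powR_ge0.
have h0 : (0 : R) <= 2^-1 by rewrite invr_ge0.
have pdf0 t : (0 <= (exponential_pdf 2^-1 t)%:E)%E.
  by rewrite lee_fin exponential_pdf_ge0.
have G0 t : (0 <= G t)%E by rewrite mule_ge0.
have mF : measurable_fun [set: R] F.
  apply/(measurable_restrictT _ (measurable_itv `]0, 1])).
  by apply: measurable_funTS; apply/measurable_EFinP; exact: measurable_powR.
have mE : measurable_fun [set: R] (fun t : R => (exponential_pdf 2^-1 t)%:E).
  by apply/measurable_EFinP; exact: measurable_exponential_pdf.
have mG : measurable_fun [set: R] G by exact: measurable_funeM.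
apply: (@le_lt_trans _ _ (\int[mu]_t (F t + G t))%E).
  apply: ge0_le_integral => //.
  - by move=> t _; rewrite lee_fin gamma_dens_ge0.
  - exact: emeasurable_gamma_dens.
  - exact: emeasurable_funD.
  move=> t _; have [t0|t0] := leP t 0; first by rewrite gamma_dens0// adde_ge0.
  rewrite gamma_densE//; have [t1|t1] := leP t 1.
    rewrite /F patchE mem_set/= ?in_itv/= ?t0//.
    apply: (le_trans _ (leeDl _ (G0 t))).
    by rewrite lee_fin ler_piMr ?powR_ge0// -expR0 ler_expR oppr_le0 ltW.
  apply: (@le_trans _ _ (G t)); last exact: leeDr.
  rewrite /G exponential_pdfE ?(ltW t0)// -EFinM lee_fin.
  have := powR_le_expR a0 (ltW t1) => /(ler_wpM2r (expR_ge0 (- t))) /le_trans; apply.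
  rewrite -!mulrA ler_wpM2l ?powR_ge0// -expRD [in leRHS]mulrA divff ?mul1r// ler_expR.
  lra.
rewrite ge0_integralD// lte_add_pinfty//.
  by rewrite -integral_mkcond (le_lt_trans (integral_powR01 a0))// ltry.
rewrite /G.
by rewrite ge0_integralZl ?lee_fin// integral_exponential_pdf ?invr_gt0// mule1 ltry.
Qed.

Lemma gamma_int_fin a : 0 < a -> gamma_int a \is a fin_num.
Proof. by move=> a0; rewrite fin_real// gamma_int_lty// (lt_trans _ (gamma_int_gt0 _)). Qed.

Lemma Gamma_gt0 a : 0 < a -> 0 < Gamma a.
Proof.
by move=> a0; rewrite Gamma_gamma_int fine_gt0// gamma_int_gt0 gamma_int_lty.
Qed.

(** Dividing the product formula by the finite positive [Gamma (a + b)] yields the value and the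
    finiteness of the beta integral at once. *)
Lemma beta_intE a b : 0 < a -> 0 < b ->
  beta_int a b = (Gamma a * Gamma b / Gamma (a + b))%:E.
Proof.
move=> a0 b0; have ab0 : 0 < a + b by rewrite addr_gt0.
have := gamma_int_mul a b.
rewrite -[gamma_int a]fineK ?gamma_int_fin// -[gamma_int b]fineK ?gamma_int_fin//.
rewrite -[gamma_int (a + b)]fineK ?gamma_int_fin// -!Gamma_gamma_int => h.
have G0 := Gamma_gt0 ab0.
by rewrite mulrC EFinM EFinM h muleA -EFinM mulVf ?mul1e// gt_eqF.
Qed.

End gamma_finite.

(** * Measurability and almost everywhere equality *)

Section tuple_measurability.
Context {R : realType} (k : nat).
Implicit Types (x y : k.-tuple R) (alpha beta : 'I_k -> R).

(** Inversion is reduced to a real power. Squaring makes the base nonnegative, where exponent [-1]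
    means inversion, and the formula also gives the conventional value 0 at 0. *)
Lemma measurable_invr : measurable_fun [set: R] (fun x : R => x^-1).
Proof.
have -> : (fun x : R => x^-1) = (fun x : R => x * (x ^+ 2) `^ (-1)).
  apply/funext => x; rewrite powR_inv1 ?sqr_ge0//.
  by have [->|x0] := eqVneq x 0; rewrite ?invr0 ?mul0r// expr2 invfM mulrA divff ?mul1r.
apply: measurable_funM => //.
apply: (measurableT_comp (measurable_powR _)).
exact: exprn_measurable.
Qed.

Lemma measurable_forall_ord d (T : measurableType d) (A : 'I_k -> set T) :
  (forall j, measurable (A j)) -> measurable [set x | forall j, A j x].
Proof.
move=> mA; rewrite (_ : [set x | _] = \bigcap_(j in [set: 'I_k]) A j).
  by apply: fin_bigcap_measurable => //; exact: finite_finset.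
by apply/seteqP; split => x /= Ax j; [move=> _|]; exact: Ax.
Qed.

Lemma measurable_psum j : measurable_fun [set: k.-tuple R] (fun x => psum x j).
Proof.
rewrite /psum; under eq_fun do rewrite big_mkcond.
apply: (@measurable_sum _ (k.-tuple R) R setT 'I_k _
  (fun i x => if (i < j)%N then tnth x i else 0)) => i.
by case: (i < j)%N => //; exact: measurable_tnth.
Qed.

Lemma measurable_dir_region : measurable (@dir_region R k).
Proof.
apply: measurable_forall_ord => j.
rewrite (_ : (fun _ => _) = ((fun x : k.-tuple R => tnth x j) @^-1` `]0, +oo[) `&`
  ((fun x : k.-tuple R => psum x j.+1) @^-1` `]0, 1[)).
  apply: measurableI; rewrite -[X in measurable X]setTI.
    by apply: (@measurable_tnth _ R k j) => //; exact: measurable_itv.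
  by apply: measurable_psum => //; exact: measurable_itv.
apply/seteqP; split => x /=; rewrite !in_itv/= andbT.
  by move=> [-> [-> ->]].
by move=> [-> /andP[-> ->]].
Qed.

Lemma measurable_f1_unnorm alpha beta :
  measurable_fun [set: k.-tuple R] (f1_unnorm alpha beta).
Proof.
apply: measurable_funM; first by apply: measurable_indic; exact: measurable_dir_region.
apply: measurable_prod => j _; apply: measurable_funM.
  exact: (measurableT_comp (measurable_powR _) (measurable_tnth j)).
apply: (measurableT_comp (measurable_powR _)).
by apply: measurable_funB => //; exact: measurable_psum.
Qed.

Lemma f1_unnorm_ge0 alpha beta x : 0 <= f1_unnorm alpha beta x.
Proof. by rewrite mulr_ge0// prodr_ge0// => j _; rewrite mulr_ge0 ?powR_ge0. Qed.

Lemma measurable_ytr : measurable_fun [set: k.-tuple R] (@ytr R k).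
Proof.
apply/measurable_fun_tnthP => i /=.
rewrite (_ : _ \o _ = (fun x => tnth x i / (1 - psum x i))); last first.
  by apply/funext => x /=; rewrite tnth_mktuple.
apply: measurable_funM; first exact: measurable_tnth.
apply: (measurableT_comp measurable_invr).
by apply: measurable_funB => //; exact: measurable_psum.
Qed.

(** With [a = alpha] and [b = gam alpha beta] this is, up to the factor [C1], the joint density of
    the [y_j]. *)
Definition bdens (a b : 'I_k -> R) y : R :=
  \prod_(j < k) beta_dens (a j) (b j) (tnth y j).

Lemma bdens_ge0 a b y : 0 <= bdens a b y.
Proof. by rewrite prodr_ge0// => j _; exact: beta_dens_ge0. Qed.

Lemma measurable_bdens a b : measurable_fun [set: k.-tuple R] (bdens a b).
Proof.
apply: measurable_prod => j _.
exact: (measurableT_comp (measurable_beta_dens _ _) (measurable_tnth j)).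
Qed.

End tuple_measurability.

(** * Product integrands and null sets *)

Section iint_facts.
Context {R : realType}.
Local Open Scope ereal_scope.

Lemma iint_prod k (h : 'I_k -> R -> R) :
  (forall j t, 0 <= h j t)%R -> (forall j, measurable_fun [set: R] (h j)) ->
  iint (fun y : k.-tuple R => (\prod_(j < k) h j (tnth y j))%:E) =
  \prod_(j < k) (\int[@lebesgue_measure R]_t (h j t)%:E).
Proof.
elim: k h => [|k IH] h h0 mh; first by rewrite /= !big_ord0.
rewrite big_ord_recl/= -IH//.
have mP : measurable_fun [set: k.-tuple R]
    (fun y : k.-tuple R => (\prod_(j < k) h (lift ord0 j) (tnth y j))%:E).
  apply/measurable_EFinP; apply: measurable_prod => j _.
  exact: (measurableT_comp (mh _) (measurable_tnth j)).
have P0 (y : k.-tuple R) : 0 <= (\prod_(j < k) h (lift ord0 j) (tnth y j))%:E.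
  by rewrite lee_fin prodr_ge0.
rewrite -ge0_integralZr//; last 3 first.
- by apply/measurable_EFinP; exact: mh.
- by move=> t _; rewrite lee_fin.
- exact: iint_ge0.
apply: eq_integral => x _; rewrite -iintZl ?lee_fin//.
congr iint; apply/funext => y; rewrite -EFinM big_ord_recl; congr (_ * _)%:E.
by apply: eq_bigr => j _; rewrite tnthS.
Qed.

(* An infinite multiple of the difference dominates the indicator. *)
Lemma iint_indic_lt0 k (F G : k.-tuple R -> \bar R) :
  (forall u, 0 <= F u) -> (forall u, F u <= G u) ->
  measurable_fun [set: k.-tuple R] F -> measurable_fun [set: k.-tuple R] G ->
  iint F = iint G -> iint F < +oo ->
  iint (fun u : k.-tuple R => (\1_[set u | (F u < G u)%E] u : R)%:E) = 0.
Proof.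
move=> F0 FG mF mG FGE Foo.
set N := [set u | F u < G u].
have mN : measurable N by rewrite -[N]setTI; exact: measurable_lte.
have m1 : measurable_fun [set: k.-tuple R] (fun u => (\1_N u : R)%:E).
  by apply/measurable_EFinP; exact: measurable_indic.
have Nfin u : u \in N -> F u \is a fin_num.
  by rewrite inE ge0_fin_numE// => /lt_le_trans; apply; exact: leey.
pose D u := (G u - F u) * (\1_N u : R)%:E.
have mD : measurable_fun [set: k.-tuple R] D.
  by apply: emeasurable_funM => //; exact: emeasurable_funB.
have D0 u : 0 <= D u.
  rewrite /D indicE; case: (boolP (u \in N)) => uN; last by rewrite mule0.
  by rewrite mule1 suber_ge0 ?Nfin.
have GE : G = fun u => F u + D u.
  apply/funext => u; rewrite /D indicE; case: (boolP (u \in N)) => uN.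
    by rewrite mule1 addeC subeK ?Nfin.
  rewrite mule0 adde0; apply/eqP; rewrite eq_le FG andbT leNgt.
  by apply: contra uN => FGu; rewrite inE.
have Ffin : iint F \is a fin_num by rewrite ge0_fin_numE// iint_ge0.
have D1 : iint D = 0.
  have GD : iint G = iint F + iint D by rewrite {1}GE iintD.
  by rewrite -(addeK (iint D) Ffin) (addeC (iint D)) -GD -FGE subee.
apply/eqP; rewrite eq_le iint_ge0 ?andbT; last by move=> t; rewrite lee_fin.
rewrite -(mule0 +oo) -D1 -iintZl//.
apply: ge0_le_iint => //.
- exact: measurable_funeM.
move=> u; rewrite indicE; case: (boolP (u \in N)) => uN; last first.
  by rewrite mule_ge0.
rewrite /D indicE uN mule1 gt0_mulye ?leey// sube_gt0.
by move: uN; rewrite inE.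
Qed.
End iint_facts.

(** * Stick breaking *)

Section stick_breaking.
Context {R : realType}.

Lemma powR_prod (I : Type) (s : seq I) (x : R) (r : I -> R) : 0 < x ->
  \prod_(i <- s) x `^ r i = x `^ (\sum_(i <- s) r i).
Proof.
move=> x0; elim: s => [|i s IH]; first by rewrite !big_nil powRr0.
by rewrite !big_cons IH powRD// (gt_eqF x0) implybT.
Qed.

Lemma psum0 k (t : k.-tuple R) : psum t 0 = 0.
Proof. by rewrite /psum big_pred0. Qed.

Lemma psum_cons k x (t : k.-tuple R) j :
  psum (cons_tuple x t) j.+1 = x + psum t j.
Proof.
rewrite /psum big_mkcond big_ord_recl/=; congr (_ + _).
by rewrite [RHS]big_mkcond; apply: eq_bigr => i _; rewrite tnthS.
Qed.

Lemma psum_tmul_nseq k c (t : k.-tuple R) j :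
  psum (tmul (nseq_tuple k c) t) j = c * psum t j.
Proof.
rewrite /psum mulr_sumr; apply: eq_bigr => i _.
by rewrite tnth_mktuple tnth_nseq.
Qed.

Lemma dir_regionP k (x : k.-tuple R) :
  dir_region x <-> forall j : 'I_k, 0 < tnth x j /\ psum x j.+1 < 1.
Proof.
split=> [h j|h j]; first by have [? [_ ?]] := h j.
have [x0 x1] := h j; do 2 split=> //.
rewrite /psum (bigD1 j) ?ltnSn//= ltr_pwDl// sumr_ge0// => i _.
by have [/ltW] := h i.
Qed.

Definition last_exponent k (beta : 'I_k -> R) (j : 'I_k) : R :=
  if val j == k.-1 then beta j - 1 else beta j.

Lemma f1_unnormE k (alpha beta : 'I_k -> R) x : f1_unnorm alpha beta x =
  \1_(@dir_region R k) x * \prod_(j < k) (tnth x j `^ (alpha j - 1) *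
      (1 - psum x j.+1) `^ last_exponent beta j).
Proof. by []. Qed.

(** Dropping the first coordinate keeps the last one last. The case [k = 0], where the predecessor
    truncates, offers no [j]. *)
Lemma last_exponent_lift k (beta : 'I_k.+1 -> R) (j : 'I_k) :
  last_exponent beta (lift ord0 j) = last_exponent (beta \o lift ord0) j.
Proof.
rewrite /last_exponent /= /bump leq0n add1n.
by case: k beta j => [beta []//|k beta j]; rewrite eqSS.
Qed.

(** The single [- 1] on the last exponent of [f1] becomes the [- 1] in the beta exponent
    [gam - 1]. *)
Lemma sum_last_exponent k (beta : 'I_k.+1 -> R) :
  \sum_(j < k.+1) last_exponent beta j = \sum_(j < k.+1) beta j - 1.
Proof.
rewrite 2!big_ord_recr/= /last_exponent /= eqxx addrA; congr (_ + _ - _).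
by apply: eq_bigr => j _; rewrite /= ltn_eqF.
Qed.

(** [gam] at an index involves no earlier parameter, so the induction can restart with the shortened
    families. *)
Lemma gam_lift k (alpha beta : 'I_k.+1 -> R) (j : 'I_k) :
  gam alpha beta (lift ord0 j) = gam (alpha \o lift ord0) (beta \o lift ord0) j.
Proof.
rewrite /gam; congr (_ + _).
  by rewrite big_mkcond big_ord_recl/= add0r [RHS]big_mkcond.
by rewrite big_mkcond big_ord_recl/= add0r [RHS]big_mkcond.
Qed.

Lemma gam0 k (alpha beta : 'I_k.+1 -> R) :
  gam alpha beta ord0 =
  \sum_(j < k) alpha (lift ord0 j) + \sum_(j < k.+1) beta j.
Proof.
rewrite /gam; congr (_ + _).
by rewrite big_mkcond big_ord_recl/= add0r.
Qed.

Section step.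
Context (k : nat) (x : R) (t : k.-tuple R).
Hypotheses (x0 : 0 < x) (x1 : x < 1).
Let c := 1 - x.
Let c0 : 0 < c. Proof. by rewrite subr_gt0. Qed.
Let z := cons_tuple x (tmul (nseq_tuple k c) t).

(** Self-similarity of the stick: once [x] is broken off, what remains at each stage is [c] times
    what remains for [t], with the index shifted by one. *)
Let oneBpsum j : 1 - psum z j.+1 = c * (1 - psum t j).
Proof. by rewrite psum_cons psum_tmul_nseq /c; ring. Qed.

(** In every later ratio the factor [c] cancels, so those [y_j] depend on [t] alone. *)
Lemma ytr_cons : ytr z = cons_tuple x (ytr t).
Proof.
apply: eq_from_tnth => i; rewrite tnth_mktuple.
case: (unliftP ord0 i) => [j ->|->]; last by rewrite psum0 subr0 divr1.
rewrite oneBpsum /z !tnthS !tnth_mktuple tnth_nseq.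
by rewrite -mulf_div divff ?gt_eqF// mul1r.
Qed.

Lemma dir_region_cons : dir_region z <-> dir_region t.
Proof.
split=> /dir_regionP h; apply/dir_regionP => j.
  have [] := h (lift ord0 j).
  rewrite -[psum _ _ < 1]subr_gt0 oneBpsum !tnthS tnth_mktuple tnth_nseq.
  by rewrite !pmulr_rgt0// subr_gt0.
rewrite -[psum _ _ < 1]subr_gt0 oneBpsum pmulr_rgt0// subr_gt0.
case: (unliftP ord0 j) => [i ->|->]; last by rewrite psum0.
by have [h1 h2] := h i; rewrite tnthS tnth_mktuple tnth_nseq pmulr_rgt0.
Qed.

(** The product on the left is the Jacobian [c^k] of scaling the tail. The rest is a count of the
    powers of [c = 1 - x]. *)
Lemma f1_unnorm_cons (alpha beta : 'I_k.+1 -> R) :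
  (\prod_(j < k) tnth (nseq_tuple k c) j) * f1_unnorm alpha beta z =
  beta_dens (alpha ord0) (gam alpha beta ord0) x *
  f1_unnorm (alpha \o lift ord0) (beta \o lift ord0) t.
Proof.
have cD r s : c `^ (r + s) = c `^ r * c `^ s.
  by rewrite powRD// (gt_eqF c0) implybT.
rewrite !f1_unnormE !indicE.
have -> : (z \in @dir_region R k.+1) = (t \in @dir_region R k).
  by apply/idP/idP; rewrite !inE dir_region_cons.
case: (boolP (t \in _)) => [|_]; last by rewrite !mul0r !mulr0.
rewrite !mul1r inE => /dir_regionP ht.
rewrite /beta_dens indicE mem_set/= ?in_itv/= ?x0// mul1r.
rewrite big_ord_recl oneBpsum psum0 subr0 mulr1 {1}/z.
have -> : \prod_(j < k) tnth (nseq_tuple k c) j = \prod_(j < k) c `^ 1.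
  by apply: eq_bigr => j _; rewrite tnth_nseq powRr1 ?ltW.
have -> : \prod_(i < k) (tnth z (lift ord0 i) `^ (alpha (lift ord0 i) - 1) *
     (1 - psum z (lift ord0 i).+1) `^ (last_exponent beta (lift ord0 i))) =
   \prod_(i < k) (c `^ (alpha (lift ord0 i) - 1 + last_exponent beta (lift ord0 i)))
   * \prod_(i < k) (tnth t i `^ (alpha (lift ord0 i) - 1) *
        (1 - psum t i.+1) `^ (last_exponent (beta \o lift ord0) i)).
  rewrite -big_split; apply: eq_bigr => j _; have [h1 h2] := ht j.
  rewrite lift0 oneBpsum /z tnthS tnth_mktuple tnth_nseq !powRM ?(ltW c0) ?(ltW h1)//; last first.
    by rewrite subr_ge0 ltW.
  by rewrite mulrACA last_exponent_lift [in RHS]cD.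
rewrite !powR_prod// tnth0 -/c.
(* The three sources of powers of [c]: the Jacobian, the first factor of the density, and the scaled
   later factors. The ones from the Jacobian cancel the [- 1] of each [alpha_j - 1]. *)
have -> : gam alpha beta ord0 - 1 = \sum_(i < k) 1 + last_exponent beta ord0 +
    \sum_(i < k) (alpha (lift ord0 i) - 1 + last_exponent beta (lift ord0 i)).
  rewrite gam0 -addrA -sum_last_exponent big_ord_recl !big_split/= sumrN; ring.
by rewrite !cD; ring.
Qed.
End step.
End stick_breaking.

(** * The law of the stick-breaking ratios and the normalizing constant *)

Section dirichlet.
Context {R : realType}.
Implicit Types k : nat.
Local Open Scope ereal_scope.

Lemma iintS k (F : k.+1.-tuple R -> \bar R) :
  iint F = \int[@lebesgue_measure R]_x iint (fun t => F (cons_tuple x t)).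
Proof. by []. Qed.

Lemma emeasurable_f1_unnorm_ytr k (alpha beta : 'I_k -> R) (H : k.-tuple R -> \bar R) :
  measurable_fun [set: k.-tuple R] H ->
  measurable_fun [set: k.-tuple R]
    (fun x => (f1_unnorm alpha beta x)%:E * H (ytr x)).
Proof.
move=> mH; apply: emeasurable_funM.
  by apply/measurable_EFinP; exact: measurable_f1_unnorm.
exact: (measurableT_comp mH (@measurable_ytr _ _)).
Qed.

Lemma emeasurable_bdens k (a b : 'I_k -> R) (H : k.-tuple R -> \bar R) :
  measurable_fun [set: k.-tuple R] H ->
  measurable_fun [set: k.-tuple R] (fun y => (bdens a b y)%:E * H y).
Proof.
move=> mH; apply: emeasurable_funM => //.
by apply/measurable_EFinP; exact: measurable_bdens.
Qed.

Lemma bdens_cons k (a b : 'I_k.+1 -> R) x (t : k.-tuple R) :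
  bdens a b (cons_tuple x t) =
  (beta_dens (a ord0) (b ord0) x * bdens (a \o lift ord0) (b \o lift ord0) t)%R.
Proof.
rewrite /bdens big_ord_recl; congr (_ * _)%R.
by apply: eq_bigr => j _; rewrite tnthS.
Qed.

(* Conditionally on [x_1], the remaining coordinates scaled by [1 / (1 - x_1)]
   have a density of the same form, with the first parameters dropped. *)
Lemma iint_f1_unnorm_ytr k (alpha beta : 'I_k -> R) (H : k.-tuple R -> \bar R) :
  (forall y, 0 <= H y) -> measurable_fun [set: k.-tuple R] H ->
  iint (fun x => (f1_unnorm alpha beta x)%:E * H (ytr x)) =
  iint (fun y => (bdens alpha (gam alpha beta) y)%:E * H y).
Proof.
elim: k alpha beta H => [|k IH] alpha beta H H0 mH.
  rewrite /= /f1_unnorm /bdens !big_ord0 mulr1 indicE mem_set; last by case.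
  by congr (_ * H _); apply: eq_from_tnth => -[].
have L0 x : 0 <= (f1_unnorm alpha beta x)%:E * H (ytr x).
  by rewrite mule_ge0 ?lee_fin ?f1_unnorm_ge0.
have mL := emeasurable_f1_unnorm_ytr alpha beta mH.
rewrite !iintS; apply: eq_integral => x _.
have mHx := measurable_fun_consl x mH.
have [/andP[x0 x1]|x01] := boolP ((0 < x)%R && (x < 1)%R); last first.
  transitivity (iint (fun _ : k.-tuple R => 0)).
    congr iint; apply/funext => t; rewrite /f1_unnorm indicE memNset ?mul0r ?mul0e//.
    move=> /dir_regionP /(_ ord0); rewrite psum_cons psum0 addr0 => -[x0 x1].
    by rewrite x0 x1 in x01.
  congr iint; apply/funext => t; rewrite bdens_cons /beta_dens indicE memNset ?mul0r ?mul0e//=.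
  by rewrite in_itv/=; apply/negP.
have c0 (j : 'I_k) : (0 < tnth (nseq_tuple k (1 - x)) j)%R by rewrite tnth_nseq subr_gt0.
(* Write the tail as [(1 - x) t]; the Jacobian is the product that [f1_unnorm_cons] absorbs. *)
rewrite (iint_tmul c0); last 2 first.
- by move=> t.
- exact: (measurable_fun_consl x mL).
pose b0 := beta_dens (alpha ord0) (gam alpha beta ord0) x.
have b00 : (0 <= b0)%R by exact: beta_dens_ge0.
rewrite -iintZl; last 3 first.
- by rewrite lee_fin prodr_ge0// => j _; exact: ltW.
- by move=> t.
- exact: (measurable_fun_tmul _ (measurable_fun_consl x mL)).
transitivity (iint (fun t => b0%:E * ((f1_unnorm (alpha \o lift ord0) (beta \o lift ord0) t)%:E
   * H (cons_tuple x (ytr t))))).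
  congr iint; apply/funext => t.
  by rewrite ytr_cons// !muleA -!EFinM f1_unnorm_cons.
rewrite iintZl ?lee_fin//; last 2 first.
- by move=> t; rewrite mule_ge0// lee_fin f1_unnorm_ge0.
- exact: (emeasurable_f1_unnorm_ytr _ _ mHx).
rewrite (IH _ _ (fun t => H (cons_tuple x t)))// -iintZl ?lee_fin//; last 2 first.
- by move=> t; rewrite mule_ge0// lee_fin bdens_ge0.
- exact: emeasurable_bdens.
have -> : gam (alpha \o lift ord0) (beta \o lift ord0) = gam alpha beta \o lift ord0.
  by apply/funext => j; rewrite /= gam_lift.
by congr iint; apply/funext => t; rewrite bdens_cons muleA -EFinM.
Qed.

(** The constant test function 1 reduces the total mass to a product of beta integrals. *)
Lemma iint_f1_unnorm k (alpha beta : 'I_k -> R) :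
  (forall j, 0 < alpha j)%R -> (forall j, 0 < gam alpha beta j)%R ->
  iint (fun x => (f1_unnorm alpha beta x)%:E) =
  (\prod_(j < k) (Gamma (alpha j) * Gamma (gam alpha beta j) /
     Gamma (alpha j + gam alpha beta j)))%:E.
Proof.
move=> a0 g0.
transitivity (iint (fun x => (f1_unnorm alpha beta x)%:E * cst 1 (ytr x))).
  by congr iint; apply/funext => x; rewrite mule1.
rewrite iint_f1_unnorm_ytr//.
transitivity (iint (fun y => (bdens alpha (gam alpha beta) y)%:E)).
  by congr iint; apply/funext => x; rewrite mule1.
rewrite (iint_prod (h := fun j => beta_dens (alpha j) (gam alpha beta j))); last 2 first.
- by move=> *; exact: beta_dens_ge0.
- by move=> j; exact: measurable_beta_dens.
rewrite -prodEFin; apply: eq_bigr => j _.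
exact: beta_intE.
Qed.

Lemma C1E k (alpha beta : 'I_k -> R) :
  (forall j, 0 < alpha j)%R -> (forall j, 0 < gam alpha beta j)%R ->
  C1 alpha beta = (\prod_(j < k) (Gamma (alpha j) * Gamma (gam alpha beta j) /
     Gamma (alpha j + gam alpha beta j)))^-1%R.
Proof. by move=> a0 g0; rewrite /C1 iint_f1_unnorm. Qed.

End dirichlet.

(** * Almost everywhere uniqueness of a density *)

Section ae_unique.
Context {R : realType} (k : nat).
Local Open Scope ereal_scope.

(** Take for [A] the set where [g < K], then the set where [K < g]. Cut off to such a set, the two
    functions are ordered and have the same finite integral, so the set where they differ is
    null. *)
Lemma density_ae_unique (g : k.-tuple R -> R) (K : k.-tuple R -> \bar R) :
  (forall u, 0 <= g u)%R -> measurable_fun [set: k.-tuple R] g ->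
  (forall u, 0 <= K u) -> measurable_fun [set: k.-tuple R] K ->
  iint (fun u => (g u)%:E) < +oo ->
  (forall A : set (k.-tuple R), measurable A ->
    iint (fun u => (\1_A u * g u)%:E) = iint (fun u => (\1_A u : R)%:E * K u)) ->
  exists N : set (k.-tuple R), tnull N /\ forall u, ~ N u -> (g u)%:E = K u.
Proof.
move=> g0 mg K0 mK goo gK.
have mG : measurable_fun [set: k.-tuple R] (fun u => (g u)%:E).
  by apply/measurable_EFinP.
pose N1 := [set u : k.-tuple R | (g u)%:E < K u]%E.
pose N2 := [set u : k.-tuple R | K u < (g u)%:E]%E.
have mN1 : measurable N1 by rewrite -[N1]setTI; exact: measurable_lte.
have mN2 : measurable N2 by rewrite -[N2]setTI; exact: measurable_lte.
have m1 A : measurable A ->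
    measurable_fun [set: k.-tuple R] (fun u : k.-tuple R => (\1_A u : R)%:E).
  by move=> mA; apply/measurable_EFinP; exact: measurable_indic.
have mAg A : measurable A ->
    measurable_fun [set: k.-tuple R] (fun u : k.-tuple R => (\1_A u * g u)%:E).
  by move=> mA; apply/measurable_EFinP; apply: measurable_funM => //; exact: measurable_indic.
have mAK A : measurable A ->
    measurable_fun [set: k.-tuple R] (fun u : k.-tuple R => (\1_A u : R)%:E * K u).
  by move=> mA; apply: emeasurable_funM => //; exact: m1.
have Ag0 A u : 0 <= (\1_A u * g u)%:E :> \bar R by rewrite lee_fin mulr_ge0.
have AK0 A u : 0 <= (\1_A u : R)%:E * K u by rewrite mule_ge0// lee_fin.
have Agoo A : measurable A -> iint (fun u : k.-tuple R => (\1_A u * g u)%:E) < +oo.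
  move=> mA; apply: le_lt_trans goo; apply: ge0_le_iint => // [|u]; first exact: mAg.
  by rewrite lee_fin ler_piMl// indicE; case: (_ \in _).
have n1 : iint (fun u => (\1_N1 u : R)%:E) = 0.
  rewrite -(@iint_indic_lt0 R k (fun u => (\1_N1 u * g u)%:E)
    (fun u => (\1_N1 u : R)%:E * K u)) ?gK//; last 4 first.
  - by move=> u; rewrite indicE; case: (boolP (u \in N1)) => uN;
      rewrite ?mul1r ?mul1e ?mul0r ?mul0e//; move: uN; rewrite inE => /ltW.
  - exact: mAg.
  - exact: mAK.
  - by rewrite -gK//; exact: Agoo.
  (* The functions cut off to [N1] differ strictly exactly on [N1]. *)
  congr iint; apply/funext => u; congr (_ _)%:E; congr (\1_ _).
  apply/seteqP; split => v /=.
    by move=> Nv; rewrite indicE mem_set// mul1r mul1e.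
  rewrite indicE; case: (boolP (v \in N1)); first by rewrite inE.
  by rewrite mul0r mul0e ltxx.
have n2 : iint (fun u => (\1_N2 u : R)%:E) = 0.
  rewrite -(@iint_indic_lt0 R k (fun u => (\1_N2 u : R)%:E * K u)
    (fun u => (\1_N2 u * g u)%:E)) ?gK//; last 4 first.
  - by move=> u; rewrite indicE; case: (boolP (u \in N2)) => uN;
      rewrite ?mul1r ?mul1e ?mul0r ?mul0e//; move: uN; rewrite inE => /ltW.
  - exact: mAK.
  - exact: mAg.
  - by rewrite -gK//; exact: Agoo.
  congr iint; apply/funext => u; congr (_ _)%:E; congr (\1_ _).
  apply/seteqP; split => v /=.
    by move=> Nv; rewrite indicE mem_set// mul1r mul1e.
  rewrite indicE; case: (boolP (v \in N2)); first by rewrite inE.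
  by rewrite mul0r mul0e ltxx.
exists (N1 `|` N2); split.
  split; first exact: measurableU.
  apply/eqP; rewrite eq_le iint_ge0 ?andbT; last by move=> u; rewrite lee_fin.
  rewrite -[leRHS](adde0 0) -{1}n1 -n2 -iintD; last 4 first.
  - by move=> u; rewrite lee_fin.
  - exact: m1.
  - by move=> u; rewrite lee_fin.
  - exact: m1.
  apply: ge0_le_iint.
  - by move=> u; rewrite lee_fin.
  - by apply: m1; exact: measurableU.
  - by apply: emeasurable_funD; exact: m1.
  move=> u; rewrite -EFinD lee_fin !indicE in_setU.
  by case: (_ \in N1); case: (_ \in N2); rewrite /= ?addr0 ?add0r// lerDl.
move=> u /not_orP[/negP + /negP]; rewrite -!leNgt => h1 h2.
by apply/eqP; rewrite eq_le h1 h2.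
Qed.

End ae_unique.

(** * The density of the quotient *)

(** Makes the denominators of the [y_j] positive; they involve the sum before [j], which is empty
    for the first index. *)
Lemma dir_region_psum_lt1 {R : realType} k (x : k.-tuple R) (j : 'I_k) :
  dir_region x -> psum x j < 1.
Proof.
case: j => [[|j] jk] /= /dir_regionP h; first by rewrite psum0.
by have [] := h (Ordinal (ltnW jk)).
Qed.

Section kober.
Context {R : realType} (k : nat) (alpha beta : 'I_k -> R).
Hypotheses (alpha0 : forall j, 0 < alpha j) (gamma0 : forall j, 0 < gam alpha beta j).
Context (f : k.-tuple R -> R).
Hypotheses (f_meas : measurable_fun [set: k.-tuple R] f) (f_ge0 : forall v, 0 <= f v).
Notation gamma := (gam alpha beta).
Implicit Types u v x y : k.-tuple R.
Local Open Scope ereal_scope.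

(** The density of [u = v / y] up to the factor [C1]. The shift of [alpha_j] by 1 comes from the
    Jacobian of [v = u y], the product of the [y_j]. *)
Definition mixed_dens u : \bar R :=
  iint (fun y => (bdens (fun j => alpha j + 1)%R gamma y * f (tmul u y))%:E).

Let measurable_f_tmul : measurable_fun [set: k.-tuple R * k.-tuple R]
  (fun p : k.-tuple R * k.-tuple R => f (tmul p.1 p.2)).
Proof. exact: (measurableT_comp f_meas (@measurable_tmul R k)). Qed.

Let measurable_mixed : measurable_fun [set: k.-tuple R * k.-tuple R]
  (fun p : k.-tuple R * k.-tuple R =>
    (bdens (fun j => alpha j + 1)%R gamma p.2 * f (tmul p.1 p.2))%:E).
Proof.
apply/measurable_EFinP; apply: measurable_funM => //.
exact: (measurableT_comp (measurable_bdens _ _) measurable_snd).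
Qed.

Lemma mixed_dens_ge0 u : 0 <= mixed_dens u.
Proof. by apply: iint_ge0 => y; rewrite lee_fin mulr_ge0 ?bdens_ge0. Qed.

Lemma measurable_mixed_dens : measurable_fun [set: k.-tuple R] mixed_dens.
Proof.
apply: (measurable_iint _ measurable_mixed) => p.
by rewrite lee_fin mulr_ge0 ?bdens_ge0.
Qed.

Lemma tmulC u v : tmul u v = tmul v u.
Proof. by apply: eq_from_tnth => i; rewrite !tnth_mktuple mulrC. Qed.

Lemma beta_dens_shift (a b t : R) :
  (beta_dens a b t * `|t| = beta_dens (a + 1) b t)%R.
Proof.
rewrite /beta_dens indicE; case: (boolP (_ \in _)); last by rewrite !mul0r.
rewrite inE/= in_itv/= => /andP[t0 _]; rewrite !mul1r gtr0_norm//.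
have -> : (a + 1 - 1 = (a - 1) + 1)%R by ring.
by rewrite [in RHS]powRD ?(gt_eqF t0) ?implybT// powRr1 ?ltW//; ring.
Qed.

Lemma bdens_shift y :
  (bdens alpha gamma y * \prod_(j < k) `|tnth y j| =
   bdens (fun j => alpha j + 1) gamma y)%R.
Proof.
by rewrite /bdens -big_split/=; apply: eq_bigr => j _; rewrite beta_dens_shift.
Qed.

(** For fixed [x], the substitution [v = u y] makes membership in [A] a condition on [u] alone. What
    is left depends on [x] only through [y], so the law of [y] applies, and Tonelli moves the
    integral over [y] inside. *)
Lemma iint_f1_mixed_dens (A : set (k.-tuple R)) : measurable A ->
  iint (fun x => iint (fun v => (f1 alpha beta x * f v * \1_A (utr x v))%:E)) =
  iint (fun u => (\1_A u : R)%:E * ((C1 alpha beta)%:E * mixed_dens u)).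
Proof.
move=> mA.
have mA1 : measurable_fun [set: k.-tuple R] (\1_A : k.-tuple R -> R).
  exact: measurable_indic.
have C0 : (0 <= C1 alpha beta)%R.
  by rewrite invr_ge0 fine_ge0// iint_ge0// => x; rewrite lee_fin f1_unnorm_ge0.
pose Q v y := (f v * \1_A [tuple tnth v i / tnth y i | i < k])%R.
have mQ y : measurable_fun [set: k.-tuple R] (fun v => (Q v y)%:E).
  apply/measurable_EFinP; apply: measurable_funM => //.
  apply: (measurableT_comp mA1); apply/measurable_fun_tnthP => i /=.
  rewrite (_ : _ \o _ = (fun v : k.-tuple R => tnth v i * (tnth y i)^-1)%R).
    by apply: measurable_funM => //; exact: measurable_tnth.
  by apply/funext => v /=; rewrite tnth_mktuple.
have Q0 v y : 0 <= (Q v y)%:E by rewrite lee_fin mulr_ge0.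
pose J y := iint (fun u => (f (tmul u y) * \1_A u)%:E).
have mfA : measurable_fun [set: k.-tuple R * k.-tuple R]
    (fun p : k.-tuple R * k.-tuple R => (f (tmul p.2 p.1) * \1_A p.2)%:E).
  apply/measurable_EFinP; apply: measurable_funM; last first.
    exact: (measurableT_comp mA1 measurable_snd).
  apply: (@measurableT_comp _ _ _ _ _ _ _ _
    (fun p : k.-tuple R * k.-tuple R => (p.2, p.1)) measurable_f_tmul).
  by apply: measurable_fun_pair.
have mJ : measurable_fun [set: k.-tuple R] J.
  by apply: (measurable_iint _ mfA) => p; rewrite lee_fin mulr_ge0.
have J0 y : 0 <= J y by apply: iint_ge0 => u; rewrite lee_fin mulr_ge0.
(* Absolute values keep the Jacobian nonnegative for every [y], so that [H] is an admissible test
   function; on positive tuples they change nothing. *)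
pose H y := (\prod_(j < k) `|tnth y j|)%:E * J y.
have mN : measurable_fun [set: k.-tuple R] (fun y => (\prod_(j < k) `|tnth y j|)%:E).
  apply/measurable_EFinP; apply: measurable_prod => j _.
  exact: (measurableT_comp (@normr_measurable R setT) (measurable_tnth j)).
have mH : measurable_fun [set: k.-tuple R] H by exact: emeasurable_funM.
have H0 y : 0 <= H y by rewrite mule_ge0 ?lee_fin ?prodr_ge0.
have QH y : (forall j, 0 < tnth y j)%R -> iint (fun v => (Q v y)%:E) = H y.
  move=> y0; rewrite (iint_tmul y0)// /H; congr (_%:E * _).
    by apply: eq_bigr => j _; rewrite gtr0_norm.
  congr iint; apply/funext => u; rewrite /Q tmulC; congr (_ * \1_A _)%:E.
  apply: eq_from_tnth => i; rewrite !tnth_mktuple mulfK// gt_eqF//.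
transitivity (iint (fun x => (C1 alpha beta)%:E * ((f1_unnorm alpha beta x)%:E * H (ytr x)))).
  congr iint; apply/funext => x.
  transitivity ((f1 alpha beta x)%:E * iint (fun v => (Q v (ytr x))%:E)).
    rewrite -iintZl//; last by rewrite lee_fin mulr_ge0 ?f1_unnorm_ge0.
    by congr iint; apply/funext => v; rewrite -EFinM mulrA.
  rewrite /f1 EFinM -muleA; congr (_ * _).
  (* The substitution requires positive [y_j], which the region guarantees; elsewhere the density
     vanishes. *)
  have [xr|xr] := boolP (x \in @dir_region R k); last first.
    by rewrite /f1_unnorm indicE (negbTE xr) !mul0r !mul0e.
  rewrite QH// => j; move: xr; rewrite inE => xr.
  rewrite tnth_mktuple divr_gt0//; first by have [] := xr j.
  by rewrite subr_gt0 dir_region_psum_lt1.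
rewrite iintZl ?lee_fin//; last 2 first.
- by move=> x; rewrite mule_ge0// lee_fin f1_unnorm_ge0.
- exact: emeasurable_f1_unnorm_ytr.
rewrite iint_f1_unnorm_ytr//.
have mB : measurable_fun [set: k.-tuple R]
    (fun y : k.-tuple R => (bdens (fun j => alpha j + 1)%R gamma y)%:E).
  by apply/measurable_EFinP; exact: measurable_bdens.
have mfAy y : measurable_fun [set: k.-tuple R] (fun u => (f (tmul u y) * \1_A u)%:E).
  exact: (measurable_fun_pair2 y mfA).
transitivity ((C1 alpha beta)%:E * iint (fun y => iint (fun u =>
    (bdens (fun j => alpha j + 1)%R gamma y)%:E * (f (tmul u y) * \1_A u)%:E))).
  congr (_ * iint _); apply/funext => y.
  rewrite iintZl// ?lee_fin ?bdens_ge0//; last by move=> u; rewrite lee_fin mulr_ge0.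
  by rewrite muleA -EFinM bdens_shift.
pose P (p : k.-tuple R * k.-tuple R) : \bar R :=
  (bdens (fun j => alpha j + 1)%R gamma p.1)%:E * (f (tmul p.2 p.1) * \1_A p.2)%:E.
have P0 p : 0 <= P p by rewrite mule_ge0 ?lee_fin ?bdens_ge0 ?mulr_ge0.
have mP : measurable_fun [set: k.-tuple R * k.-tuple R] P.
  by apply: emeasurable_funM => //; exact: (measurableT_comp mB measurable_fst).
have mPC : measurable_fun [set: k.-tuple R * k.-tuple R]
    (fun p : k.-tuple R * k.-tuple R => P (p.2, p.1)).
  by apply: (measurableT_comp mP); exact: measurable_fun_pair.
rewrite (iint_swap P0 mP) -iintZl ?lee_fin//; last 2 first.
- by move=> u; apply: iint_ge0.
- exact: (measurable_iint _ mPC).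
congr iint; apply/funext => u; rewrite muleCA; congr (_ * _).
rewrite /mixed_dens -iintZl ?lee_fin//; last 2 first.
- by move=> y; rewrite lee_fin mulr_ge0 ?bdens_ge0.
- exact: (measurable_fun_pair2 u measurable_mixed).
by congr iint; apply/funext => y; rewrite /P -!EFinM; congr EFin; ring.
Qed.

(** Putting [v = u y] extracts [u_j^(alpha_j + gamma_j - 1)] from the kernel and [u_j] from the
    Jacobian; together they cancel the prefactor [u_j^(- alpha_j - gamma_j)], leaving only
    [1 / Gamma (gamma_j)]. *)
Lemma kober_mixed_dens u : (forall j, 0 < tnth u j)%R ->
  kober alpha gamma f u =
  (\prod_(j < k) (Gamma (gamma j))^-1)%:E * mixed_dens u.
Proof.
move=> u0.
pose W v := (\1_[set w : k.-tuple R | forall j, (0 < tnth w j < tnth u j)%R] v *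
      \prod_(j < k) ((tnth u j - tnth v j) `^ (gamma j - 1) * tnth v j `^ alpha j) *
      f v)%R.
have mW : measurable_fun [set: k.-tuple R] (fun v => (W v)%:E).
  apply/measurable_EFinP; apply: measurable_funM => //; apply: measurable_funM.
    apply: measurable_indic; apply: measurable_forall_ord => j.
    rewrite -[X in measurable X]setTI.
    exact: (@measurable_tnth _ R k j measurableT _ (measurable_itv `]0%R, tnth u j[)).
  apply: measurable_prod => j _; apply: measurable_funM.
    apply: (measurableT_comp (measurable_powR _)).
    by apply: measurable_funB => //; exact: measurable_tnth.
  exact: (measurableT_comp (measurable_powR _) (measurable_tnth j)).
have W0 v : 0 <= (W v)%:E.
  rewrite lee_fin !mulr_ge0// prodr_ge0// => j _.
  by rewrite mulr_ge0 ?powR_ge0.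
have WE y : W (tmul u y) = (\prod_(j < k) tnth u j `^ (alpha j + gamma j - 1) *
    (bdens (fun j => alpha j + 1) gamma y * f (tmul u y)))%R.
  rewrite /W mulrA; congr (_ * _)%R.
  rewrite indicE; case: (boolP (_ \in _)) => [|yn].
    rewrite inE/= => uy; rewrite mul1r /bdens -big_split; apply: eq_bigr => j _.
    have := uy j; rewrite tnth_mktuple pmulr_rgt0// gtr_pMr// => /andP[y0 y1].
    have y1' : (0 < 1 - tnth y j)%R by rewrite subr_gt0.
    rewrite /beta_dens indicE mem_set/= ?in_itv/= ?y0// mul1r addrK.
    rewrite -[X in (X - _)%R]mulr1 -mulrBr !powRM ?(ltW (u0 j)) ?(ltW y0) ?(ltW y1')//.
    have -> : (alpha j + gamma j - 1 = (gamma j - 1) + alpha j)%R by ring.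
    by rewrite [in RHS]powRD ?(gt_eqF (u0 j)) ?implybT//; ring.
  rewrite mul0r.
  (* Outside the box of integration some [y_j] leaves []0, 1[], and its beta factor vanishes. *)
  have [j yj] : exists j, ~ (0 < tnth y j < 1)%R.
    apply/existsNP => h; move/negP: yn; apply; rewrite inE/= => j.
    rewrite tnth_mktuple pmulr_rgt0// gtr_pMr//.
  suff -> : bdens (fun j => alpha j + 1)%R gamma y = 0%R by rewrite mulr0.
  by rewrite /bdens (bigD1 j)//= [beta_dens _ _ _]/beta_dens indicE memNset ?mul0r//=.
rewrite /kober -/W (iint_tmul u0)//.
have -> : iint (fun t => (W (tmul u t))%:E) =
    (\prod_(j < k) tnth u j `^ (alpha j + gamma j - 1))%:E * mixed_dens u.
  rewrite /mixed_dens -iintZl; last 3 first.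
  - by rewrite lee_fin prodr_ge0// => j _; exact: powR_ge0.
  - by move=> y; rewrite lee_fin mulr_ge0 ?bdens_ge0.
  - exact: (measurable_fun_pair2 u measurable_mixed).
  by congr iint; apply/funext => y; rewrite WE EFinM.
rewrite !muleA -!EFinM -!big_split/=; congr (_%:E * _); apply: eq_bigr => j _.
have uj := u0 j.
have -> : (- alpha j - gamma j = - (alpha j + gamma j))%R by ring.
rewrite powRN -mulrA mulr_powRB1 ?(ltW uj) ?(addr_gt0 (alpha0 j) (gamma0 j))//.
have P0 := powR_gt0 (alpha j + gamma j) uj.
by rewrite mulrAC mulVf ?mul1r// gt_eqF.
Qed.

End kober.

Theorem theorem2p5 (R : realType) (k : nat) (hk : (0 < k)%N)
    (alpha beta : 'I_k -> R)
    (halpha : forall j, 0 < alpha j)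
    (hgam : forall j, 0 < gam alpha beta j)
    (f : k.-tuple R -> R)
    (f_meas : measurable_fun [set: k.-tuple R] f)
    (f_ge0 : forall v, 0 <= f v)
    (f_supp : forall v, ~ (forall j, 0 < tnth v j) -> f v = 0)
    (f_tot : iint (fun v => (f v)%:E) = 1%E)
    (g : k.-tuple R -> R)
    (g_meas : measurable_fun [set: k.-tuple R] g)
    (g_ge0 : forall u, 0 <= g u)
    (g_dens : forall A : set (k.-tuple R), measurable A ->
       iint (fun u => (\1_A u * g u)%:E) =
       iint (fun x => iint (fun v =>
               (f1 alpha beta x * f v * \1_A (utr x v))%:E))) :
  exists N : set (k.-tuple R), tnull N /\
    forall u : k.-tuple R, (forall j, 0 < tnth u j) -> ~ N u ->
      kober alpha (gam alpha beta) f u =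
      ((\prod_(j < k) (Gamma (alpha j) / Gamma (alpha j + gam alpha beta j)))
         * g u)%:E.

Proof.
have C0 : 0 <= C1 alpha beta.
  by rewrite invr_ge0 fine_ge0// iint_ge0// => x; rewrite lee_fin f1_unnorm_ge0.
pose K u := ((C1 alpha beta)%:E * mixed_dens alpha beta f u)%E.
have K0 u : (0 <= K u)%E by rewrite mule_ge0// mixed_dens_ge0.
have mK : measurable_fun [set: k.-tuple R] K.
  by apply: measurable_funeM; exact: measurable_mixed_dens.
(* Testing on the whole space gives the mass of [f1], since [f] has mass 1; it is finite by the
   Dirichlet integral. *)
have goo : (iint (fun u => (g u)%:E) < +oo)%E.
  have -> : iint (fun u => (g u)%:E) = iint (fun u => (\1_[set: k.-tuple R] u * g u)%:E).
    by congr iint; apply/funext => u; rewrite indicT mul1r.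
  rewrite g_dens//.
  have -> : iint (fun x => iint (fun v =>
      (f1 alpha beta x * f v * \1_[set: k.-tuple R] (utr x v))%:E)) =
      iint (fun x => ((C1 alpha beta)%:E * (f1_unnorm alpha beta x)%:E)%E).
    congr iint; apply/funext => x; rewrite -[RHS]mule1 -f_tot -EFinM -iintZl//.
    - by congr iint; apply/funext => v; rewrite indicT mulr1 EFinM.
    - by rewrite lee_fin mulr_ge0 ?f1_unnorm_ge0.
    - by apply/measurable_EFinP.
  rewrite iintZl ?lee_fin//.
  - by rewrite iint_f1_unnorm// -EFinM ltry.
  - by move=> x; rewrite lee_fin f1_unnorm_ge0.
  - by apply/measurable_EFinP; exact: measurable_f1_unnorm.
have [|N [N0 gK]] := density_ae_unique g_ge0 g_meas K0 mK goo.
  by move=> A mA; rewrite g_dens// iint_f1_mixed_dens.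
exists N; split => // u u0 /gK gu.
have G0 (j : 'I_k) : [/\ 0 < Gamma (alpha j), 0 < Gamma (gam alpha beta j) &
    0 < Gamma (alpha j + gam alpha beta j)].
  by split; apply: Gamma_gt0 => //; exact: addr_gt0 (halpha j) (hgam j).
(* Both sides are multiples of [mixed_dens]. Factor by factor, [Gamma alpha_j / Gamma (alpha_j +
   gamma_j)] times the [j]-th factor of [C1] is [1 / Gamma gamma_j]. *)
rewrite kober_mixed_dens// [RHS]EFinM gu /K C1E// muleA -EFinM.
congr (_%:E * _)%E; rewrite -prodf_div; apply: eq_bigr => j _.
have [a0 b0 c0] := G0 j.
by field; rewrite !gt_eqF.
Qed.
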